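(* Let $R$ be an associative ring with identity such that the category $R\text{-}\mathsf{mod}$ of finitely presented left $R$-modules has enough projective objects as an exact category, let $n\ge0$ be an integer, and let $M,N$ be finitely presented left $R$-modules. If $\mathrm{Ext}^i_R(M,R)=0$ for all $1\le i\le n$, then $$\mathrm{Ext}^n_R(M,\Omega^nN)/\mathcal{P}\;\cong\;\underline{\mathrm{Hom}}_R(M,N).$$
   Context: $R\text{-}\mathsf{mod}$ is regarded as an exact category whose conflations are the short exact sequences with all terms finitely presented; having enough projectives means that every finitely presented left module $X$ admits a short exact sequence $0\to K\to P\to X\to0$ with $P$ finitely generated projective and $K$ finitely presented. $\Omega^nN$ is an $n$-th syzygy of $N$ in $R\text{-}\mathsf{mod}$: the left end of an exact sequence $0\to\Omega^nN\to P_{n-1}\to\cdots\to P_0\to N\to0$ of finitely presented modules, a splice of conflations, with each $P_i$ projective ($\Omega^0N=N$). $\mathcal{P}$ is the subgroup of $\mathrm{Ext}^n_R(M,\Omega^nN)$ of elements of the form $f\beta$ (push-out of the extension class $\beta$ along $f$; composition if $n=0$) with $f:P\to\Omega^nN$, $P$ finitely generated projective, and $\beta\in\mathrm{Ext}^n_R(M,P)$. $\underline{\mathrm{Hom}}_R(M,N)$ is $\mathrm{Hom}_R(M,N)$ modulo the subgroup of morphisms factoring through a projective module. The isomorphism is of abelian groups. *)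

(* Defs.v *)
From HB Require Import structures.
From mathcomp Require Import all_boot all_order all_algebra.
From mathcomp Require Import boolp.

Set Implicit Arguments.
Unset Strict Implicit.
Unset Printing Implicit Defensive.
Import GRing.Theory.
Local Open Scope ring_scope.
Local Open Scope quotient_scope.

(* [pzRingType]: associative rings with 1, not assumed commutative, the zero
   ring being allowed. [lmodType R]: left R-modules. *)

Definition surj (A B : Type) (f : A -> B) : Prop := forall y, exists x, f x = y.

Section HomGroup.
Variables (R : pzRingType) (U V : lmodType R).
Implicit Types f g h : {linear U -> V}.

Lemma lin_eqP f g : f =1 g -> f = g.
Proof.
case: f g => [f [[a] [b]]] [g [[c] [e]]] /= /funext fg; subst g.
by rewrite (Prop_irrelevance a c) (Prop_irrelevance b e).
Qed.

HB.instance Definition _ := gen_eqMixin {linear U -> V}.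
HB.instance Definition _ := gen_choiceMixin {linear U -> V}.

Definition lin_zero : {linear U -> V} := \0.
Definition lin_opp f : {linear U -> V} := \- f.
Definition lin_add f g : {linear U -> V} := f \+ g.

Lemma lin_addA : associative lin_add.
Proof. by move=> f g h; apply: lin_eqP => x /=; rewrite addrA. Qed.
Lemma lin_addC : commutative lin_add.
Proof. by move=> f g; apply: lin_eqP => x /=; rewrite addrC. Qed.
Lemma lin_add0 : left_id lin_zero lin_add.
Proof. by move=> f; apply: lin_eqP => x /=; rewrite add0r. Qed.
Lemma lin_addN : left_inverse lin_zero lin_opp lin_add.
Proof. by move=> f; apply: lin_eqP => x /=; rewrite addNr. Qed.

HB.instance Definition _ := GRing.isZmodule.Build {linear U -> V}
  lin_addA lin_addC lin_add0 lin_addN.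

Lemma lin0E x : (0 : {linear U -> V}) x = 0. Proof. by []. Qed.
Lemma linDE f g x : (f + g) x = f x + g x. Proof. by []. Qed.
Lemma linNE f x : (- f) x = - f x. Proof. by []. Qed.
Lemma linBE f g x : (f - g) x = f x - g x. Proof. by []. Qed.

End HomGroup.

Definition lcomp (R : pzRingType) (U V W : lmodType R)
  (g : {linear V -> W}) (f : {linear U -> V}) : {linear U -> W} := g \o f.

Section Modules.
Variable R : pzRingType.
Implicit Types K M N P X : lmodType R.

Definition finitely_generated M : Prop :=
  exists (k : nat) (p : {linear 'rV[R]_k -> M}), surj p.

Definition finitely_presented M : Prop :=
  exists (k m : nat) (p : {linear 'rV[R]_k -> M})
    (r : {linear 'rV[R]_m -> 'rV[R]_k}),
    surj p /\ forall v, p v = 0 <-> exists u, r u = v.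

Definition projective P : Prop :=
  forall (A B : lmodType R) (g : {linear A -> B}) (h : {linear P -> B}),
    surj g -> exists k : {linear P -> A}, forall x, g (k x) = h x.

Definition fg_projective P : Prop := finitely_generated P /\ projective P.

Definition short_exact K P X (i : {linear K -> P}) (p : {linear P -> X}) : Prop :=
  [/\ injective i, surj p & forall y, p y = 0 <-> exists x, i x = y].

(* The conflations of the exact category R-mod. *)
Definition conflation K P X (i : {linear K -> P}) (p : {linear P -> X}) : Prop :=
  [/\ finitely_presented K, finitely_presented P, finitely_presented X
    & short_exact i p].

Definition enough_projectives : Prop :=
  forall X, finitely_presented X ->
    exists (K P : lmodType R) (i : {linear K -> P}) (p : {linear P -> X}),
      fg_projective P /\ conflation i p.

(* [syzygy Z n N]: Z is an n-th syzygy of N, i.e. the left end of a splice of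
   n conflations 0 -> K_{j+1} -> P_j -> K_j -> 0 with P_j projective, K_0 = N
   and K_n = Z. *)
Inductive syzygy (Z : lmodType R) : nat -> lmodType R -> Prop :=
| syzygy0 : syzygy Z 0 Z
| syzygyS n K P N (i : {linear K -> P}) (p : {linear P -> N}) :
    conflation i p -> projective P -> syzygy Z n K -> syzygy Z n.+1 N.

Lemma projective0 : projective ('rV[R]_0 : lmodType R).
Proof.
move=> A B g h _; exists \0 => x /=; rewrite linear0.
by rewrite (_ : x = 0) ?linear0 //; apply/rowP; case.
Qed.

Lemma projective_prod P Q : projective P -> projective Q ->
  projective (P * Q)%type.
Proof.
move=> projP projQ A B g h gsurj.
have inl_lin : linear (fun x : P => (x, 0 : Q)).
  by move=> a x y; congr pair; rewrite /= scaler0 addr0.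
have inr_lin : linear (fun y : Q => (0 : P, y)).
  by move=> a x y; congr pair; rewrite /= scaler0 addr0.
pose inl_ : {linear P -> (P * Q)%type} := HB.pack (fun x : P => (x, 0 : Q))
  (GRing.isLinear.Build R P (P * Q)%type *:%R _ inl_lin).
pose inr_ : {linear Q -> (P * Q)%type} := HB.pack (fun y : Q => (0 : P, y))
  (GRing.isLinear.Build R Q (P * Q)%type *:%R _ inr_lin).
have [k kE] := projP _ _ g (lcomp h inl_) gsurj.
have [l lE] := projQ _ _ g (lcomp h inr_) gsurj.
exists (lcomp k fst + lcomp l snd) => -[x y].
rewrite linDE linearD /= kE lE /= -linearD; congr (h _).
by congr pair; rewrite ?addr0 ?add0r.
Qed.

Lemma finitely_generated0 : finitely_generated ('rV[R]_0 : lmodType R).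
Proof. by exists 0%N, idfun => x; exists x. Qed.

Lemma finitely_generated_prod M N :
  finitely_generated M -> finitely_generated N ->
  finitely_generated (M * N)%type.
Proof.
move=> [k [p psurj]] [l [q qsurj]]; exists (k + l)%N.
have pq_lin : linear (fun v : 'rV[R]_(k + l) => (p (lsubmx v), q (rsubmx v))).
  by move=> a x y; congr pair; rewrite /= !linearP.
pose pq : {linear 'rV[R]_(k + l) -> (M * N)%type} :=
  HB.pack (fun v : 'rV[R]_(k + l) => (p (lsubmx v), q (rsubmx v)))
    (GRing.isLinear.Build R 'rV[R]_(k + l) (M * N)%type *:%R _ pq_lin).
exists pq => -[x y]; have [u <-] := psurj x; have [v <-] := qsurj y.
by exists (row_mx u v); rewrite /= row_mxKl row_mxKr.
Qed.

Lemma fg_projective_prod P Q :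
  fg_projective P -> fg_projective Q -> fg_projective (P * Q)%type.
Proof.
by move=> [? ?] [? ?]; split;
  [apply: finitely_generated_prod | apply: projective_prod].
Qed.

End Modules.

Section StableHom.
Variables (R : pzRingType) (M N : lmodType R).

Definition factors_projective : {pred {linear M -> N}} := fun f =>
  `[< exists (P : lmodType R) (g : {linear M -> P}) (h : {linear P -> N}),
        projective P /\ f = lcomp h g >].

Lemma factors_projective_zmod_closed : zmod_closed factors_projective.
Proof.
split=> [|_ _ /asboolP[P [g [h [projP ->]]]] /asboolP[Q [k [l [projQ ->]]]]].
  apply/asboolP; exists 'rV[R]_0, 0, 0; split; first exact: projective0.
  exact: lin_eqP.
have gk_lin : linear (fun x : M => (g x, k x)).
  by move=> a x y; congr pair; rewrite /= linearP.
pose gk : {linear M -> (P * Q)%type} := HB.pack (fun x : M => (g x, k x))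
  (GRing.isLinear.Build R M (P * Q)%type *:%R _ gk_lin).
apply/asboolP; exists (P * Q)%type, gk, (lcomp h fst - lcomp l snd).
by split; [apply: projective_prod | apply: lin_eqP].
Qed.

HB.instance Definition _ := GRing.isZmodClosed.Build {linear M -> N}
  factors_projective factors_projective_zmod_closed.

Definition stable_Hom : zmodType := Quotient.quot factors_projective.

End StableHom.

Section Complexes.
Variables (R : pzRingType) (M : lmodType R).

(* A sequence ... -> C_2 -> C_1 -> C_0 -> M, with no condition imposed yet. *)
Record augmented_seq := AugmentedSeq {
  obj :> nat -> lmodType R;
  diff : forall i, {linear obj i.+1 -> obj i};
  aug : {linear obj 0 -> M} }.

Definition exact_at_obj (C : augmented_seq) (i : nat) : Prop :=
  match i with
  | 0 => forall y : C 0%N, aug C y = 0 <-> exists x, diff C 0 x = y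
  | j.+1 => forall y : C j.+1, diff C j y = 0 <-> exists x, diff C j.+1 x = y
  end.

Record projective_resolution := ProjectiveResolution {
  res_seq :> augmented_seq;
  res_projective : forall i, projective (res_seq i);
  res_aug_surj : surj (aug res_seq);
  res_exact : forall i, exact_at_obj res_seq i }.

End Complexes.

Section Cocycles.
Variables (R : pzRingType) (M : lmodType R) (Q : projective_resolution M).
Variables (n : nat) (X : lmodType R).

Definition is_cocycle : {pred {linear Q n -> X}} :=
  fun c => `[< forall y, c (diff Q n y) = 0 >].

Lemma is_cocycle_zmod_closed : zmod_closed is_cocycle.
Proof.
split=> [|c b /asboolP cP /asboolP bP]; apply/asboolP => y; rewrite ?lin0E //.
by rewrite linBE cP bP subr0.
Qed.

HB.instance Definition _ := GRing.isZmodClosed.Build {linear Q n -> X}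
  is_cocycle is_cocycle_zmod_closed.

Record cocycle := Cocycle {
  cocycle_fun :> {linear Q n -> X};
  cocycle_funP : cocycle_fun \in is_cocycle }.

HB.instance Definition _ := [isSub for cocycle_fun].
HB.instance Definition _ := [Choice of cocycle by <:].
HB.instance Definition _ := [SubChoice_isSubZmodule of cocycle by <:].

End Cocycles.

Section Ext.
Variables (R : pzRingType) (M : lmodType R) (Q : projective_resolution M).

Definition coboundary_fun (n : nat) (X : lmodType R) :
    {linear Q n -> X} -> Prop :=
  match n with
  | 0 => fun c => c = 0
  | m.+1 => fun c => exists b : {linear Q m -> X}, c = lcomp b (diff Q m)
  end.

Definition is_coboundary (n : nat) (X : lmodType R) : {pred cocycle Q n X} :=
  fun c => `[< coboundary_fun (cocycle_fun c) >].

Lemma is_coboundary_zmod_closed n X : zmod_closed (@is_coboundary n X).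
Proof.
case: n => [|n]; split.
- exact/asboolP.
- by move=> c b /asboolP /= cE /asboolP /= bE; apply/asboolP; rewrite /= cE bE subrr.
- by apply/asboolP; exists 0; apply: lin_eqP.
- move=> c b /asboolP[c' cE] /asboolP[b' bE]; apply/asboolP; exists (c' - b').
  by rewrite /= cE bE; apply: lin_eqP.
Qed.

HB.instance Definition _ n X := GRing.isZmodClosed.Build (cocycle Q n X)
  (@is_coboundary n X) (@is_coboundary_zmod_closed n X).

(* Ext^n_R(M, X) = H^n(Hom_R(Q, X)). The choice of the projective resolution Q
   of M only changes it up to canonical isomorphism, and is left explicit. *)
Definition Ext (n : nat) (X : lmodType R) : zmodType :=
  Quotient.quot (@is_coboundary n X).

Definition ext_cls (n : nat) (X : lmodType R) (c : cocycle Q n X) : Ext n X :=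
  \pi_(Ext n X) c.

End Ext.
Section ExtMap.
Variables (R : pzRingType) (M : lmodType R) (Q : projective_resolution M).
Variable n : nat.
Implicit Types X Y : lmodType R.

Lemma cocycle_map_subproof X Y (f : {linear X -> Y}) (c : cocycle Q n X) :
  lcomp f c \in @is_cocycle _ _ Q n Y.
Proof.
by apply/asboolP => y /=; have /asboolP -> := cocycle_funP c; rewrite linear0.
Qed.

Definition cocycle_map X Y (f : {linear X -> Y}) (c : cocycle Q n X) :
  cocycle Q n Y := Cocycle (cocycle_map_subproof f c).

(* Ext^n_R(M, f), induced by composing cocycles with f. *)
Definition ext_map X Y (f : {linear X -> Y}) (z : Ext Q n X) : Ext Q n Y :=
  ext_cls (cocycle_map f (repr z)).

Lemma ext_cls_eqP X (c b : cocycle Q n X) :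
  ext_cls c = ext_cls b <-> coboundary_fun (cocycle_fun c - cocycle_fun b).
Proof.
split=> [/eqP|H]; last (apply/eqP; move: H).
  by rewrite /ext_cls -Quotient.idealrBE => /asboolP.
by rewrite /ext_cls -Quotient.idealrBE => H; apply/asboolP.
Qed.

Lemma ext_clsK X (z : Ext Q n X) : ext_cls (repr z) = z.
Proof. exact: reprK. Qed.

Lemma ext_cls0 X : ext_cls (0 : cocycle Q n X) = 0.
Proof. by rewrite /ext_cls piE. Qed.

Lemma ext_clsB X (c b : cocycle Q n X) : ext_cls (c - b) = ext_cls c - ext_cls b.
Proof. by rewrite /ext_cls [RHS]piE. Qed.

Lemma ext_map_cls X Y (f : {linear X -> Y}) (c : cocycle Q n X) :
  ext_map f (ext_cls c) = ext_cls (cocycle_map f c).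
Proof.
apply/ext_cls_eqP; have /ext_cls_eqP : ext_cls (repr (ext_cls c)) = ext_cls c.
  exact: ext_clsK.
move: (repr _) => b; case: c b; rewrite /cocycle_map /=.
case: n => [|m] c cP b /=.
  by move/eqP; rewrite subr_eq0 => /eqP ->; rewrite subrr.
move=> [a aE]; exists (lcomp f a); apply: lin_eqP => x.
by rewrite linBE /= -linearB -linBE aE.
Qed.

(* The elements f beta with beta in Ext^n_R(M, P) and f : P -> X. *)
Definition in_calP X : {pred Ext Q n X} := fun z =>
  `[< exists (P : lmodType R) (f : {linear P -> X}) (beta : Ext Q n P),
        fg_projective P /\ z = ext_map f beta >].

Lemma in_calP_zmod_closed X : zmod_closed (@in_calP X).
Proof.
split=> [|_ _ /asboolP[P [f [z [projP ->]]]] /asboolP[P' [g [w [projP' ->]]]]].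
  apply/asboolP; exists 'rV[R]_0, 0, 0.
  split; first by split; [exact: finitely_generated0 | exact: projective0].
  by rewrite -(ext_cls0 X) -(ext_cls0 'rV[R]_0) ext_map_cls; congr ext_cls; apply/val_inj/lin_eqP.
rewrite -(ext_clsK z) -(ext_clsK w); move: (repr z) (repr w) => {z w} c b.
have cb_lin : linear (fun x : Q n => (c x, b x)).
  by move=> a x y; congr pair; rewrite /= linearP.
pose cb : {linear Q n -> (P * P')%type} := HB.pack (fun x : Q n => (c x, b x))
  (GRing.isLinear.Build R (Q n) (P * P')%type *:%R _ cb_lin).
have cbP : cb \in @is_cocycle _ _ Q n (P * P')%type.
  apply/asboolP => y /=; have /asboolP -> := cocycle_funP c.
  by have /asboolP -> := cocycle_funP b.
apply/asboolP; exists (P * P')%type, (lcomp f fst - lcomp g snd).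
exists (ext_cls (Cocycle cbP)); split; first exact: fg_projective_prod.
rewrite !ext_map_cls -ext_clsB; congr ext_cls.
by apply/val_inj/lin_eqP.
Qed.

HB.instance Definition _ X := GRing.isZmodClosed.Build (Ext Q n X)
  (@in_calP X) (@in_calP_zmod_closed X).

Definition Ext_mod_calP X : zmodType := Quotient.quot (@in_calP X).

End ExtMap.

Definition zmod_isomorphic (A B : zmodType) : Prop :=
  exists phi : {additive A -> B}, bijective phi.

(* Enough projectives gives every finitely presented module a resolution by
   finitely generated projectives. *)
Section ResolutionExists.
Variables (R : pzRingType) (enough : enough_projectives R).

Record cover (X : lmodType R) := Cover {
  cov_ker : lmodType R;
  cov_obj : lmodType R;
  cov_inc : {linear cov_ker -> cov_obj};
  cov_map : {linear cov_obj -> X};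
  cov_fgP : fg_projective cov_obj;
  cov_conf : conflation cov_inc cov_map }.

Lemma cover_exists X : finitely_presented X -> inhabited (cover X).
Proof. by move=> /enough[K [P [i [p [fgP ip]]]]]; exists; exists K P i p. Qed.

Lemma cover_ker_fp X (c : cover X) : finitely_presented (cov_ker c).
Proof. by have [] := cov_conf c. Qed.

Lemma resolution_exists (M : lmodType R) : finitely_presented M ->
  exists Q : projective_resolution M, forall i, fg_projective (Q i).
Proof.
move=> fpM.
have [c0] := cover_exists fpM.
pose nxt (X : lmodType R) (c : cover X) : cover (cov_ker c) :=
  projT1 (cid (match cover_exists (cover_ker_fp c) with
               | inhabits c' => ex_intro (fun=> True) c' I end)).
pose K := fix K i : {X : lmodType R & cover X} :=
  if i is j.+1 then existT _ (cov_ker (projT2 (K j))) (nxt _ (projT2 (K j)))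
  else existT _ M c0.
pose P i := cov_obj (projT2 (K i)).
pose d i : {linear P i.+1 -> P i} :=
  lcomp (cov_inc (projT2 (K i))) (cov_map (projT2 (K i.+1))).
pose S := @AugmentedSeq R M P d (cov_map c0).
have exact_gen X (c : cover X) :
  forall y, cov_map c y = 0 <->
    exists x, cov_inc c (cov_map (nxt _ c) x) = y.
  move=> y; have [_ _ _ [_ _ ->]] := cov_conf c.
  split=> [[x <-]|[x <-]]; last by eexists.
  by have [_ _ _ [_ /(_ x)[z <-] _]] := cov_conf (nxt _ c); exists z.
have exS i : exact_at_obj S i.
  case: i => [|i]; first exact: exact_gen.
  move=> y; rewrite /S /= -exact_gen /=.
  have [_ _ _ [inj_i _ _]] := cov_conf (projT2 (K i)).
  by split=> [|->]; [rewrite -[RHS](linear0 (cov_inc (projT2 (K i)))) => /inj_i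
                    | rewrite linear0].
have surjS : surj (aug S) by have [_ _ _ []] := cov_conf c0.
have projS i : fg_projective (S i) by exact: cov_fgP.
by exists (ProjectiveResolution (fun i => (projS i).2) surjS exS).
Qed.

End ResolutionExists.

(* Compatibility with the description of Ext by extensions: the class of
   0 -> C_{n+1} -> C_n -> ... -> C_0 -> M -> 0 is that of the last component of
   a lift Q -> C of the identity of M. Along the morphism of extensions given
   by a push-out, which is the identity on M, classes are transported by
   [ext_map]. *)
Section ExtensionClass.
Variables (R : pzRingType) (M : lmodType R) (Q : projective_resolution M).
Variable n : nat.
Implicit Types C D : augmented_seq M.

Definition extension C : Prop :=
  [/\ surj (aug C), forall i, (i <= n)%N -> exact_at_obj C i
    & injective (diff C n)].

Definition seq_morphism C D (h : forall i, {linear C i -> D i}) : Prop :=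
  (forall x, aug D (h 0%N x) = aug C x) /\
  forall i, (i <= n)%N -> forall x, diff D i (h i.+1 x) = h i (diff C i x).

Definition extension_class C (z : Ext Q n.+1 (C n.+1)) : Prop :=
  exists (t : forall i, {linear Q i -> C i}) (c : cocycle Q n.+1 (C n.+1)),
    [/\ seq_morphism t, cocycle_fun c = t n.+1 & z = ext_cls c].

Lemma extension_class_pushout C D (h : forall i, {linear C i -> D i}) z :
  extension C -> extension D -> seq_morphism h ->
  extension_class z -> @extension_class D (ext_map (h n.+1) z).
Proof.
move=> _ _ [h0 hS] [t [c [[t0 tS] cE zE]]].
exists (fun i => lcomp (h i) (t i)), (cocycle_map (h n.+1) c).
split; first split.
- by move=> x /=; rewrite h0 t0.
- by move=> i lein x /=; rewrite hS // tS.
- by rewrite /= cE.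
- by rewrite zE ext_map_cls.
Qed.

End ExtensionClass.

(* Main.v *)
(** Dimension shifting. For a conflation [0 -> K -> P -> N -> 0] with [P]
    projective, every map from a projective to [N] lifts to [P], so [calP] in
    [Ext^j(M, N)] is the image of [Ext^j(M, P)], that is, the kernel of the
    connecting map to [Ext^{j+1}(M, K)]. If [Ext^{j+1}(M, R) = 0], then
    [Ext^{j+1}(M, -)] vanishes on finitely generated projectives; hence the
    connecting map is onto and [calP] is zero in its target. *)

Require Import Defs.
From HB Require Import structures.
From mathcomp Require Import all_boot all_order all_algebra.
From mathcomp Require Import boolp.

Set Implicit Arguments.
Unset Strict Implicit.
Unset Printing Implicit Defensive.
Import GRing.Theory.
Local Open Scope ring_scope.
Local Open Scope quotient_scope.

(** * Isomorphisms of abelian groups and of their quotients *)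

Lemma zmod_isomorphic_refl (A : zmodType) : zmod_isomorphic A A.
Proof. by exists idfun; exists idfun. Qed.

Lemma zmod_isomorphic_trans (B A C : zmodType) :
  zmod_isomorphic A B -> zmod_isomorphic B C -> zmod_isomorphic A C.
Proof.
move=> [f fbij] [g gbij].
by exists (g \o f : {additive A -> C}); apply: bij_comp.
Qed.

Lemma zmod_isomorphic_sym (A B : zmodType) :
  zmod_isomorphic A B -> zmod_isomorphic B A.
Proof.
move=> [f [g fK gK]].
have g_zmod : zmod_morphism g.
  by move=> x y; apply: (can_inj fK); rewrite raddfB !gK.
pose g' : {additive B -> A} := HB.pack g (GRing.isZmodMorphism.Build B A g g_zmod).
by exists g', f.
Qed.

(* An additive correspondence, total on both sides, between the groups before
   quotienting; using a relation avoids choosing lifts additively. *)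
Lemma quot_isomorphic_of_correspondence (A B : zmodType)
  (S : zmodClosed A) (T : zmodClosed B) (r : A -> B -> Prop) :
  (forall a b a' b', r a b -> r a' b' -> r (a - a') (b - b')) ->
  (forall a, exists b, r a b) -> (forall b, exists a, r a b) ->
  (forall a b, r a b -> (a \in S) = (b \in T)) ->
  zmod_isomorphic (Quotient.quot S) (Quotient.quot T).
Proof.
move=> rB r_l r_r rST.
have [f fP] := choice r_l; have [g gP] := choice r_r.
pose piS (a : A) : Quotient.quot S := \pi_(Quotient.quot S) a.
pose piT (b : B) : Quotient.quot T := \pi_(Quotient.quot T) b.
have piSK x : piS (repr x) = x by exact: reprK.
have piTK x : piT (repr x) = x by exact: reprK.
have piSP a a' : piS a = piS a' <-> a - a' \in S.
  by rewrite Quotient.idealrBE; split=> [/eqP | /eqP].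
have piTP b b' : piT b = piT b' <-> b - b' \in T.
  by rewrite Quotient.idealrBE; split=> [/eqP | /eqP].
pose phi (x : Quotient.quot S) := piT (f (repr x)).
pose psi (y : Quotient.quot T) := piS (g (repr y)).
(* As [r] is closed under differences and matches [S] with [T], [phi] depends neither on the
   representative nor on the chosen partner. *)
have phiE a b : r a b -> phi (piS a) = piT b.
  move=> rab; apply/piTP; rewrite -(rST _ _ (rB _ _ _ _ (fP _) rab)).
  by apply/piSP; rewrite piSK.
have psiE a b : r a b -> psi (piT b) = piS a.
  move=> rab; apply/piSP; rewrite (rST _ _ (rB _ _ _ _ (gP _) rab)).
  by apply/piTP; rewrite piTK.
have phi_zmod : zmod_morphism phi.
  move=> x y; rewrite -[x]piSK -[y]piSK.
  have -> : piS (repr x) - piS (repr y) = piS (repr x - repr y).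
    by rewrite /piS [LHS]piE.
  rewrite (phiE _ _ (rB _ _ _ _ (fP _) (fP _))).
  by rewrite !(phiE _ _ (fP _)) /piT [RHS]piE.
exists (HB.pack_for {additive Quotient.quot S -> Quotient.quot T} phi
  (GRing.isZmodMorphism.Build _ _ phi phi_zmod)).
exists psi => x /=.
  by rewrite -[x]piSK (phiE _ _ (fP _)) (psiE _ _ (fP _)).
by rewrite -[x]piTK (psiE _ _ (gP _)) (phiE _ _ (gP _)).
Qed.

(** * Factoring linear maps, and coordinates of free modules *)

Section LinearFactorization.
Variable R : pzRingType.
Implicit Types U V W : lmodType R.

Lemma linear_factor_inj U V W (i : {linear V -> W}) (g : {linear U -> W}) :
  injective i -> (forall x, exists y, i y = g x) ->
  exists e : {linear U -> V}, forall x, i (e x) = g x.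
Proof.
move=> inj_i /choice[e eE].
have e_lin : linear e by move=> a x y; apply: inj_i; rewrite linearP !eE linearP.
by exists (HB.pack_for {linear U -> V} e (GRing.isLinear.Build R U V *:%R _ e_lin)).
Qed.

(** The section [s] of [p] is only set-theoretic; [g \o s] is linear because [g] is constant on the
    fibres of [p]. *)
Lemma linear_factor_surj U V W (p : {linear U -> V}) (g : {linear U -> W}) :
  surj p -> (forall x, p x = 0 -> g x = 0) ->
  exists e : {linear V -> W}, forall x, e (p x) = g x.
Proof.
move=> /choice[s sE] gker.
have gE x y : p x = p y -> g x = g y.
  move=> pxy; apply/eqP; rewrite -subr_eq0 -linearB; apply/eqP/gker.
  by rewrite linearB pxy subrr.
have e_lin : linear (g \o s).
  by move=> a x y /=; rewrite -linearP; apply: gE; rewrite linearP !sE.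
exists (HB.pack_for {linear V -> W} (g \o s)
  (GRing.isLinear.Build R V W *:%R _ e_lin)) => x /=.
by apply: gE; rewrite sE.
Qed.

Lemma linear_row U (k : nat) (f : 'I_k -> {linear U -> R^o}) :
  exists g : {linear U -> 'rV[R]_k}, forall x j, g x 0 j = f j x.
Proof.
have g_lin : linear (fun x : U => \row_j (f j x : R)).
  by move=> a x y; apply/rowP => j; rewrite !mxE linearP.
exists (HB.pack_for {linear U -> 'rV[R]_k} (fun x : U => \row_j (f j x : R))
  (GRing.isLinear.Build R U 'rV[R]_k *:%R _ g_lin)) => x j /=.
by rewrite mxE.
Qed.

Lemma linear_coord (k : nat) (j : 'I_k) :
  exists g : {linear 'rV[R]_k -> R^o}, forall v, g v = v 0 j.
Proof.
have g_lin : linear (fun v : 'rV[R]_k => v 0 j : R^o).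
  by move=> a x y; rewrite !mxE.
by exists (HB.pack_for {linear 'rV[R]_k -> R^o} (fun v : 'rV[R]_k => v 0 j : R^o)
  (GRing.isLinear.Build R 'rV[R]_k R^o *:%R _ g_lin)).
Qed.

End LinearFactorization.

Lemma finitely_presented_generated (R : pzRingType) (M : lmodType R) :
  finitely_presented M -> finitely_generated M.
Proof. by move=> [k [m [p [r [psurj _]]]]]; exists k, p. Qed.

(** * Cocycles, and the shift of degree along a conflation *)

Section DimensionShift.
Variables (R : pzRingType) (M : lmodType R) (Q : projective_resolution M).
Implicit Types X Y K P N : lmodType R.

Lemma diff_diff j x : diff Q j (diff Q j.+1 x) = 0.
Proof. by apply/(res_exact Q j.+1); exists x. Qed.

Lemma aug_diff x : aug Q (diff Q 0 x) = 0.
Proof. by apply/(res_exact Q 0); exists x. Qed.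

Lemma cocycle_diff j X (c : cocycle Q j X) y : c (diff Q j y) = 0.
Proof. by have /asboolP := cocycle_funP c. Qed.

Lemma cocycle_of j X (c : {linear Q j -> X}) :
  (forall y, c (diff Q j y) = 0) ->
  exists c' : cocycle Q j X, cocycle_fun c' = c.
Proof.
move=> cP; have c_cocycle : c \in @is_cocycle _ _ Q j X by apply/asboolP.
by exists (Cocycle c_cocycle).
Qed.

Lemma ext_clsP j X (z : Ext Q j X) : exists c, z = ext_cls c.
Proof. by exists (repr z); rewrite ext_clsK. Qed.

Lemma ext_cls_eq0 j X (c : cocycle Q j X) :
  ext_cls c = 0 <-> coboundary_fun (cocycle_fun c).
Proof.
rewrite -(ext_cls0 Q j X) ext_cls_eqP.
by rewrite (_ : cocycle_fun c - _ = c) //; apply: lin_eqP => x /=; rewrite subr0.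
Qed.

Lemma coboundary_diff j X (c : {linear Q j -> X}) y :
  coboundary_fun c -> c (diff Q j y) = 0.
Proof.
case: j c y => [|j] c y /=; first by move->.
by move=> [b ->] /=; rewrite diff_diff linear0.
Qed.

Lemma coboundary_lift j X Y (p : {linear X -> Y}) (c : {linear Q j -> Y}) :
  surj p -> coboundary_fun c ->
  exists2 b : {linear Q j -> X}, coboundary_fun b & forall x, p (b x) = c x.
Proof.
case: j c => [|j] c psurj /=.
  by move->; exists 0 => // x; rewrite linear0.
move=> [a ->]; have [b bE] := res_projective a psurj.
by exists (lcomp b (diff Q j)); [exists b | move=> x /=; rewrite bE].
Qed.

(** [P] is a retract of a free module of finite rank: each coordinate of [s c] is a coboundary, and
    [p] maps the row of their primitives to a primitive of [c]. *)
Lemma Ext_fg_projective_eq0 j P (z : Ext Q j.+1 P) :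
  (forall w : Ext Q j.+1 R^o, w = 0) -> fg_projective P -> z = 0.
Proof.
move=> Ext0 [[k [p psurj]] projP]; have [c ->] := ext_clsP z.
have [s sE] := projP _ _ p idfun psurj.
have coord_cobound (l : 'I_k) : exists b : {linear Q j -> R^o},
    forall x, b (diff Q j x) = s (c x) 0 l.
  have [g gE] := linear_coord R l.
  have /ext_cls_eq0[b bE] := Ext0 (ext_cls (cocycle_map (lcomp g s) c)).
  by exists b => x; rewrite -gE; move/(congr1 (fun f : {linear _ -> _} => f x)): bE.
have [b bE] := choice coord_cobound; have [b' b'E] := linear_row b.
apply/ext_cls_eq0; exists (lcomp p b'); apply: lin_eqP => x /=.
rewrite -[LHS]sE; congr (p _); apply/rowP => l.
by rewrite b'E bE.
Qed.

Lemma Ext_mod_calP_shift j K P N (i : {linear K -> P}) (p : {linear P -> N}) :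
  (forall w : Ext Q j.+1 R^o, w = 0) -> conflation i p -> projective P ->
  zmod_isomorphic (Ext_mod_calP Q j N) (Ext_mod_calP Q j.+1 K).
Proof.
move=> Ext0 [_ fpP _ [inj_i psurj ker_p]] projP.
have fgP : fg_projective P by split=> //; apply: finitely_presented_generated.
have pi0 x : p (i x) = 0 by apply/ker_p; exists x.
apply: (@quot_isomorphic_of_correspondence _ _ _ _
  (* The graph of the connecting map: [b] is a cochain lifting [c] to [P], and [e] is its
     differential read in [K]. *)
  (fun (z : Ext Q j N) (w : Ext Q j.+1 K) =>
   exists (c : cocycle Q j N) (e : cocycle Q j.+1 K) (b : {linear Q j -> P}),
   [/\ z = ext_cls c, w = ext_cls e, forall x, p (b x) = c x
     & forall y, i (e y) = b (diff Q j y)])).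
- move=> _ _ _ _ [c [e [b [-> -> cE eE]]]] [c' [e' [b' [-> -> cE' eE']]]].
  exists (c - c'), (e - e'), (b - b'); rewrite !ext_clsB; split=> // x.
    by rewrite linBE linearB cE cE'.
  by rewrite linBE linearB eE eE'.
- move=> z; have [c ->] := ext_clsP z.
  have [b bE] := res_projective c psurj.
  have [|e eE] := @linear_factor_inj R _ _ _ i (lcomp b (diff Q j)) inj_i.
    by move=> x; apply/ker_p; rewrite /= bE cocycle_diff.
  have [y|e' e'E] := @cocycle_of j.+1 K e.
    by apply: inj_i; rewrite eE linear0 /= diff_diff linear0.
  by exists (ext_cls e'), c, e', b; split=> // y; rewrite e'E eE.
(* The connecting map is onto: [i e] has a primitive [b] since its class in [Ext Q j.+1 P] vanishes,
   and [p b] is the cocycle sought. *)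
- move=> w; have [e ->] := ext_clsP w.
  have /ext_cls_eq0[b bE] :=
    Ext_fg_projective_eq0 (ext_cls (cocycle_map i e)) Ext0 fgP.
  have {}bE y : b (diff Q j y) = i (e y).
    by move/(congr1 (fun f : {linear _ -> _} => f y)): bE.
  have [y|c cE] := @cocycle_of j N (lcomp p b); first by rewrite /= bE pi0.
  by exists (ext_cls c), c, e, b; split=> // x; rewrite cE.
move=> _ _ [c [e [b [-> -> cE eE]]]]; apply/asboolP/asboolP.
(* Here [c] is [f b'] plus a coboundary. Lifting both to [P], as [g b'] and [a], leaves
   [b - g b' - a] with values in [K]; it is a primitive of [e], because [g b'] and [a] vanish on
   boundaries. *)
- move=> [P' [f [beta [[_ projP'] fbeta]]]].
  have [g gE] := projP' _ _ p f psurj.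
  have [b' b'E] := ext_clsP beta.
  move: fbeta; rewrite b'E ext_map_cls => /ext_cls_eqP.
  move=> /(coboundary_lift psurj)[a a_cob aE].
  have [|k kE] := @linear_factor_inj R _ _ _ i (b - lcomp g b' - a) inj_i.
    move=> x; apply/ker_p; rewrite !linBE !linearB cE aE linBE /= gE.
    by rewrite subrr.
  have -> : ext_cls e = 0.
    apply/ext_cls_eq0; exists k; apply: lin_eqP => y /=; apply: inj_i.
    by rewrite kE !linBE /= cocycle_diff linear0 (coboundary_diff _ a_cob) !subr0 eE.
  by have /asboolP := rpred0 (@in_calP _ _ Q j.+1 K).
(* Conversely [beta] is zero, so [e] has a primitive [k]. Then [b - i k] is a cocycle in [P] that
   [p] sends to [c]. *)
- move=> [P' [f [beta [fgP' fbeta]]]].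
  move: fbeta; rewrite (Ext_fg_projective_eq0 beta Ext0 fgP').
  rewrite -(ext_cls0 Q j.+1 P') ext_map_cls => /ext_cls_eqP[k kE].
  have {}kE y : e y = k (diff Q j y).
    move/(congr1 (fun h : {linear _ -> _} => h y)): kE => /=.
    by rewrite linear0 subr0.
  have [y|b' b'E] := @cocycle_of j P (b - lcomp i k).
    by rewrite linBE /= -kE eE subrr.
  exists P, p, (ext_cls b'); split=> //; rewrite ext_map_cls; congr ext_cls.
  apply/val_inj/lin_eqP => x /=.
  by rewrite b'E linBE /= linearB cE pi0 subr0.
Qed.

(** Since [aug Q] is a cokernel of [diff Q 0], cocycles of degree 0 are the maps out of [M],
    composed with [aug Q]. *)
Lemma Ext_mod_calP_stable_Hom N :
  enough_projectives R -> finitely_presented N ->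
  zmod_isomorphic (Ext_mod_calP Q 0 N) (stable_Hom M N).
Proof.
move=> enough /enough[_ [P [_ [q [fgP [_ _ _ [_ qsurj _]]]]]]].
have descend X (c : cocycle Q 0 X) :
    exists f : {linear M -> X}, forall x, f (aug Q x) = c x.
  apply: linear_factor_surj (res_aug_surj Q) _ => x.
  by move/(res_exact Q 0) => [y <-]; rewrite cocycle_diff.
have ascend X (f : {linear M -> X}) :
    exists c : cocycle Q 0 X, forall x, f (aug Q x) = c x.
  have [y|c cE] := @cocycle_of 0 X (lcomp f (aug Q)).
    by rewrite /= aug_diff linear0.
  by exists c => x; rewrite cE.
apply: (@quot_isomorphic_of_correspondence _ _ _ _
  (fun (z : Ext Q 0 N) (f : {linear M -> N}) =>
   exists2 c : cocycle Q 0 N, z = ext_cls c & forall x, f (aug Q x) = c x)).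
- move=> _ f _ f' [c -> cE] [c' -> cE'].
  by exists (c - c') => [|x]; rewrite ?ext_clsB // !linBE cE cE'.
- move=> z; have [c ->] := ext_clsP z; have [f fE] := descend _ c.
  by exists f, c.
- by move=> f; have [c cE] := ascend _ f; exists (ext_cls c), c.
move=> _ f [c -> cE]; apply/asboolP/asboolP.
- move=> [P' [g [beta [[_ projP'] gbeta]]]].
  have [b bE] := ext_clsP beta; have [h hE] := descend _ b.
  move: gbeta; rewrite bE ext_map_cls => /ext_cls_eqP /= /eqP.
  rewrite subr_eq0 => /eqP gbE.
  exists P', h, g; split=> //; apply: lin_eqP => y.
  by have [x <-] := res_aug_surj Q y; rewrite cE gbE /= hE.
(* [P'] may fail to be finitely generated, while [in_calP] asks for this; lifting [h] along [q]
   replaces [P'] by the finitely generated projective [P]. *)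
- move=> [P' [g [h [projP' fE]]]].
  have [h' h'E] := projP' _ _ q h qsurj.
  have [b bE] := ascend _ (lcomp h' g).
  exists P, q, (ext_cls b); split=> //; rewrite ext_map_cls; congr ext_cls.
  by apply/val_inj/lin_eqP => x /=; rewrite -bE -cE fE /= h'E.
Qed.

(** The degree [j] is left free for the induction: each conflation trades one syzygy step for one
    degree, so [j + n] stays constant. *)
Lemma Ext_mod_calP_syzygy n N Z j : syzygy Z n N ->
  (forall i, (1 <= i <= j + n)%N -> forall w : Ext Q i R^o, w = 0) ->
  zmod_isomorphic (Ext_mod_calP Q j N) (Ext_mod_calP Q (j + n) Z).
Proof.
move=> syz; elim: syz j => {n N} [j _ | n K P N i p ip projP _ IH j Ext0].
  by rewrite addn0; apply: zmod_isomorphic_refl.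
apply: (zmod_isomorphic_trans (B := Ext_mod_calP Q j.+1 K)).
  apply: Ext_mod_calP_shift ip projP; apply: Ext0.
  by rewrite addnS /= ltnS leq_addr.
by rewrite -addSnnS in Ext0 *; apply: IH.
Qed.

End DimensionShift.

Theorem corollary3p12 (R : pzRingType) (n : nat) (M N Z : lmodType R)
  (hR : enough_projectives R)
  (hM : finitely_presented M) (hN : finitely_presented N)
  (hZ : syzygy Z n N)
  (Q : projective_resolution M)
  (hExt : forall i : nat, (1 <= i <= n)%N -> forall z : Ext Q i R^o, z = 0) :
  zmod_isomorphic (Ext_mod_calP Q n Z) (stable_Hom M N).
Proof.
(* Starting from degree 0, the shifts meet exactly the degrees from 1 to [n]. *)
have NZ := @Ext_mod_calP_syzygy R M Q n N Z 0 hZ hExt.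
apply: zmod_isomorphic_trans (zmod_isomorphic_sym NZ) _.
exact: Ext_mod_calP_stable_Hom.
Qed.
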